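(* Let $k$ and $\lambda$ be odd positive integers, and let $\mathcal F$ be a $k$-MOFS$(2\lambda)$ that satisfies a full relation. Then $\mathcal F$ is maximal, i.e. there is no binary frequency square of order $2\lambda$ orthogonal to every member of $\mathcal F$.
   Context: Let $N(n)=\{1,\dots,n\}$ and let $n$ be even. A (binary) frequency square of order $n$ is an $n\times n$ array indexed by $N(n)\times N(n)$ with entries in $\{0,1\}$ such that every row and every column contains exactly $n/2$ zeros and $n/2$ ones. Two frequency squares $F,G$ of order $n$ are orthogonal if for each $(a,b)\in\{0,1\}^2$ the number of cells $(r,c)$ with $(F[r,c],G[r,c])=(a,b)$ equals $n^2/4$. A $k$-MOFS$(n)$ is an ordered set $F_1,\dots,F_k$ of pairwise orthogonal frequency squares of order $n$. Relations: form the $n^2\times(k+2)$ array $\mathcal O$ having a row $(i,j,F_1[i,j],\dots,F_k[i,j])$ for each $(i,j)\in N(n)^2$. Let $Y_1=Y_2=N(n)$ and $Y_c=\{0,1\}$ for $3\le c\le k+2$. A relation is a tuple $(X_1,\dots,X_{k+2})$ with $X_c\subseteq Y_c$ for all $c$ such that every row of $\mathcal O$ has an even number of positions $c$ for which the $c$-th entry of the row lies in $X_c$. A relation is trivial on column $c$ if $X_c=\emptyset$ or $X_c=Y_c$; it is full if it is non-trivial on every column $c\in\{1,\dots,k+2\}$ except possibly one of the columns $1,2$. *)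

(* Defs.v *)
From mathcomp Require Import all_boot all_algebra.

Set Implicit Arguments.
Unset Strict Implicit.
Unset Printing Implicit Defensive.

(* Entries 0 and 1 are [false] and [true]; N(n) = {1, ..., n} is ['I_n].
   For odd n the definition is unsatisfiable, since then n./2 + n./2 < n. *)
Definition frequency_square (n : nat) (F : 'M[bool]_n) : Prop :=
  (forall (r : 'I_n) (a : bool), #|[set c : 'I_n | F r c == a]| = n./2) /\
  (forall (c : 'I_n) (a : bool), #|[set r : 'I_n | F r c == a]| = n./2).

Definition orthogonal (n : nat) (F G : 'M[bool]_n) : Prop :=
  forall a b : bool,
    #|[set rc : 'I_n * 'I_n | (F rc.1 rc.2, G rc.1 rc.2) == (a, b)]|
    = (n ^ 2) %/ 4.

Definition MOFS (n k : nat) (F : 'I_k -> 'M[bool]_n) : Prop :=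
  (forall i : 'I_k, frequency_square (F i)) /\
  (forall i j : 'I_k, i != j -> orthogonal (F i) (F j)).

(* The k + 2 columns of the array O: [inl ord0] is column 1 (row index),
   [inl ord_max] is column 2 (column index), and [inr s] is the column of the
   square F s. *)
Definition column (k : nat) : finType := ('I_2 + 'I_k)%type.

(* The sets Y_c. *)
Definition symbol (n k : nat) (c : column k) : finType :=
  match c with inl _ => 'I_n | inr _ => bool end.

Definition entry (n k : nat) (F : 'I_k -> 'M[bool]_n) (i j : 'I_n)
    (c : column k) : symbol n c :=
  match c return symbol n c with
  | inl t => if t == ord0 then i else j
  | inr s => F s i j
  end.

Definition relation (n k : nat) (F : 'I_k -> 'M[bool]_n)
    (X : forall c : column k, {set symbol n c}) : Prop :=
  forall i j : 'I_n, ~~ odd #|[set c : column k | entry F i j c \in X c]|.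

Definition trivial_on (n k : nat) (X : forall c : column k, {set symbol n c})
    (c : column k) : Prop :=
  X c = set0 \/ X c = setT.

Definition full (n k : nat) (X : forall c : column k, {set symbol n c}) : Prop :=
  exists t : 'I_2, forall c : column k, c != inl t -> ~ trivial_on X c.

Definition maximal (n k : nat) (F : 'I_k -> 'M[bool]_n) : Prop :=
  ~ exists G : 'M[bool]_n,
      frequency_square G /\ forall i : 'I_k, orthogonal (F i) G.

(* Main.v *)
Require Import Defs.
From mathcomp Require Import all_boot all_algebra.

(** Suppose [G] is orthogonal to every [F s].  For a frequency square [H],
    count the incidences (cell with [H = 1], column [c] whose entry lies in
    [X c]): the relation makes the total even.  Columns 1 and 2 contribute
    [lambda * (#|X_1| + #|X_2|)] whatever [H] is; the column of a square
    orthogonal to [H] contributes [lambda ^ 2], which is odd; and the column of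
    [H] itself contributes [0] or [2 * lambda ^ 2], which is even.  Taking
    [H = G] gives [k] odd contributions from the squares and [H = F s0] gives
    [k - 1], so the two totals have different parities. *)

Definition incidences (n k : nat) (F : 'I_k -> 'M[bool]_n)
    (X : forall c : column k, {set symbol n c}) (H : 'M[bool]_n)
    (c : column k) : nat :=
  \sum_(i < n) \sum_(j < n) (H i j && (entry F i j c \in X c)).

Arguments incidences {n k} F X H c.

Lemma sum_pairs_card (n : nat) (P : 'I_n -> 'I_n -> bool) :
  \sum_(i < n) \sum_(j < n) P i j = #|[set rc : 'I_n * 'I_n | P rc.1 rc.2]|.
Proof.
rewrite pair_big /= -sum1_card big_mkcond [RHS]big_mkcond /=.
by apply: eq_bigr => rc _; rewrite inE; case: (P _ _).
Qed.

Lemma sum_bool_card (T : finType) (P : pred T) :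
  \sum_(x : T) P x = #|[set x | P x]|.
Proof.
by rewrite -sum1_card [RHS]big_mkcond; apply: eq_bigr => x _; rewrite inE; case: (P x).
Qed.

Lemma frequency_square_row (n : nat) (H : 'M[bool]_n) (i : 'I_n) :
  frequency_square H -> \sum_(j < n) H i j = n./2.
Proof.
move=> [rowH _]; rewrite sum_bool_card -(rowH i true).
by apply: eq_card => j; rewrite !inE eqb_id.
Qed.

Lemma frequency_square_col (n : nat) (H : 'M[bool]_n) (j : 'I_n) :
  frequency_square H -> \sum_(i < n) H i j = n./2.
Proof.
move=> [_ colH]; rewrite (sum_bool_card _ (fun i => H i j)) -(colH j true).
by apply: eq_card => i; rewrite !inE eqb_id.
Qed.

Lemma odd_sum_const (I : finType) (P : pred I) (f : I -> nat) (b : bool) :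
  (forall i, P i -> odd (f i) = b) -> odd (\sum_(i | P i) f i) = odd #|P| && b.
Proof.
move=> fb; rewrite -sum1_card; symmetry.
elim/big_rec2: _ => // i x y Pi IH.
by rewrite !oddD fb // -IH /=; case: (odd y) (b) => - [].
Qed.

Section Incidences.

Variables (n k : nat) (F : 'I_k -> 'M[bool]_n).
Variable X : forall c : column k, {set symbol n c}.

(** Summed cell by cell: where [H i j] is false nothing is counted, and elsewhere the count over [c]
    is the one that [relation] makes even. *)
Lemma relation_incidences_even (H : 'M[bool]_n) :
  relation F X -> ~~ odd (\sum_(c : column k) incidences F X H c).
Proof.
move=> relX; rewrite /incidences exchange_big /=.
apply: (big_ind (fun m => ~~ odd m)) => // [x y /negPf xe /negPf ye|i _].
  by rewrite oddD xe ye.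
rewrite exchange_big /=.
apply: (big_ind (fun m => ~~ odd m)) => // [x y /negPf xe /negPf ye|j _].
  by rewrite oddD xe ye.
case: (H i j) => /=; last by rewrite big1.
by rewrite (sum_bool_card _ (fun c => entry F i j c \in X c)).
Qed.

(** Each row and each column of [H] holds [n./2] ones, so every index in [X (inl t)] contributes
    [n./2]. *)
Lemma incidences_index (H : 'M[bool]_n) (t : 'I_2) :
  frequency_square H -> incidences F X H (inl t) = n./2 * #|X (inl t)|.
Proof.
move=> sqH; rewrite /incidences /=.
transitivity (\sum_(i < n) (n./2 * (i \in X (inl t)))); last first.
  rewrite -big_distrr /= sum_bool_card; congr (_ * _).
  by apply: eq_card => i; rewrite !inE.
case: (t == ord0).
  apply: eq_bigr => i _; rewrite -(frequency_square_row _ H i sqH) big_distrl /=.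
  by apply: eq_bigr => j _; rewrite mulnb.
rewrite exchange_big /=; apply: eq_bigr => j _.
rewrite -(frequency_square_col _ H j sqH) big_distrl /=.
by apply: eq_bigr => i _; rewrite mulnb.
Qed.

Lemma nontrivial_symbol (s : 'I_k) :
  ~ trivial_on X (inr s) ->
  exists b : bool, forall a : bool, (a \in X (inr s)) = (a == b).
Proof.
move=> ntX.
case tX: (true \in X (inr s)); case fX: (false \in X (inr s)).
- by case: ntX; right; apply/setP => - []; rewrite inE.
- by exists true; case.
- by exists false; case.
- by case: ntX; left; apply/setP => - []; rewrite inE.
Qed.

(** As [X (inr s)] is a singleton [b], the cells counted are those of the single pair
    [(b, true)]. *)
Lemma incidences_orthogonal (H : 'M[bool]_n) (s : 'I_k) :
  ~ trivial_on X (inr s) -> Defs.orthogonal (F s) H ->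
  incidences F X H (inr s) = (n ^ 2) %/ 4.
Proof.
move=> /nontrivial_symbol[b Xb] orthH.
rewrite /incidences sum_pairs_card -(orthH b true).
by apply: eq_card => rc; rewrite !inE /= Xb xpair_eqE eqb_id andbC.
Qed.

Lemma incidences_self (s : 'I_k) :
  ~ trivial_on X (inr s) -> ~~ odd n -> frequency_square (F s) ->
  ~~ odd (incidences F X (F s) (inr s)).
Proof.
move=> /nontrivial_symbol[b Xb] evn sqF; rewrite /incidences /=.
under eq_bigr => i _ do under eq_bigr => j _ do rewrite Xb.
(* For [b = true] all ones of [F s] count, and [n * n./2] is even through its factor [n]; for
   [b = false] no cell counts. *)
case: b Xb => _.
  under eq_bigr => i _ do under eq_bigr => j _ do rewrite eqb_id andbb.
  under eq_bigr => i _ do rewrite (frequency_square_row _ _ i sqF).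
  by rewrite sum_nat_const card_ord oddM (negPf evn).
by rewrite big1 // => i _; rewrite big1 // => j _; case: (F s i j).
Qed.

End Incidences.

Theorem theorem2p3 (k lambda : nat) (F : 'I_k -> 'M[bool]_(2 * lambda)) :
  odd k -> odd lambda ->
  MOFS F ->
  (exists X : forall c : column k, {set symbol (2 * lambda) c},
     relation F X /\ full X) ->
  maximal F.
Proof.
move=> oddk oddl [sqF orthF] [X [relX [t0 fullX]]] [G [sqG orthG]].
have ntX s : ~ trivial_on X (inr s) by apply: fullX.
have k_gt0 : 0 < k by case: (k) oddk.
pose s0 := Ordinal k_gt0.
have odd_orth H s : Defs.orthogonal (F s) H -> odd (incidences F X H (inr s)).
  move=> orthH; rewrite (incidences_orthogonal _ _ _ _ _ _ (ntX s) orthH).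
  (* Here [(2 * lambda) ^ 2 %/ 4 = lambda ^ 2]. *)
  by rewrite expnMn mulKn // oddX oddl orbT.
have even_self : ~~ odd (incidences F X (F s0) (inr s0)).
  by apply: incidences_self => //; rewrite oddM.
have := relation_incidences_even _ _ F X G relX.
have := relation_incidences_even _ _ F X (F s0) relX.
rewrite !big_sumType /= !oddD.
(* Columns 1 and 2 are brought to one and the same sum in both totals, first for [F s0], then for
   [G]. *)
rewrite (eq_bigr (fun t => (2 * lambda)./2 * #|X (inl t)|)); last first.
  by move=> t _; apply: incidences_index.
rewrite [in X in _ -> X](eq_bigr (fun t => (2 * lambda)./2 * #|X (inl t)|)); last first.
  by move=> t _; apply: incidences_index.
(* Removing the even term [s0] leaves [k.-1] odd terms for [F s0], against [k] for [G]. *)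
rewrite (bigD1 s0) //= oddD (negPf even_self) /=.
rewrite (odd_sum_const 'I_k _ _ true) => [|s s_neq0]; last exact/odd_orth/orthF.
rewrite (odd_sum_const 'I_k _ _ true) => [|s _]; last exact/odd_orth/orthG.
have -> : #|[pred s : 'I_k | s != s0]| = k.-1 by rewrite cardC1 card_ord.
have -> : odd k.-1 = false by case: (k) oddk => //= k' /negPf.
(* Whatever the parity of the shared sum, one of the two totals is odd. *)
by rewrite card_ord oddk; case: (odd _).
Qed.
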